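(* Let $(X,D)$ be a Kähler snc pair and let $\mathsf{N}\subset\mathrm{Nef}(X,D)$ be a nice cone. Then the interior of $\mathsf{N}$ is contained in $\mathrm{Amp}_{\mathrm{nice}}(X,D)$.
   Context: A snc pair $(X,D)$ is a smooth compact complex manifold $X$ with a simple normal crossings divisor $D=\bigcup_{p\in P}D_p$ (irreducible components). $H^2(X,X\setminus D;\mathbb{R})\cong\mathbb{R}^P$ is identified with $\mathbb{R}$-divisors supported on $D$. $\mathrm{Nef}(X,D)\subset\mathbb{R}^P$ is the closed cone of effective nef divisors supported on $D$; $\mathrm{Amp}(X,D)\subset\mathbb{R}^P$ is the open cone of ample divisors $\sum_p\ell_pD_p$ with $\ell_p>0$ for all $p$. $(X,D)$ is Kähler if $\mathrm{Amp}(X,D)\ne\emptyset$. For $K\subset P$ let $\bar K=P\setminus K$, $D_K=\bigcap_{p\in K}D_p$ (with $D_\emptyset=X$) and $D^K=\bigcup_{p\in\bar K}D_p$, so that $\mathrm{Amp}(X,D^K)\subset H^2(X,X\setminus D^K;\mathbb{R})\cong\mathbb{R}^{\bar K}$ maps to $H^2(X;\mathbb{R})$. Define $$\mathrm{Amp}'(X,D)=\bigcap_{K:D_K\neq\emptyset}\mathrm{im}\big(\mathrm{Amp}(X,D^K)\to H^2(X;\mathbb{R})\big),$$ and let $\mathrm{Amp}_{\mathrm{nice}}(X,D)$ be the interior of $\{a\in\mathrm{Amp}(X,D):\mathrm{im}(a)\in\mathrm{Amp}'(X,D)\}$, where $\mathrm{im}(a)$ is the image of $a$ in $H^2(X;\mathbb{R})$.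 A full-dimensional convex sub-cone $\mathsf{N}\subset\mathrm{Nef}(X,D)$ is nice if, with $\mathsf{N}^K=\mathsf{N}\cap\mathbb{R}^{\bar K}$, for all $K$ with $D_K\ne\emptyset$: $\mathsf{N}^K\subset\mathbb{R}^{\bar K}$ is full-dimensional, and the image of $\mathsf{N}$ under $H^2(X,X\setminus D;\mathbb{R})\to H^2(X;\mathbb{R})$ equals the image of $\mathsf{N}^K$. *)

(* Defs.v *)
From HB Require Import structures.
From mathcomp Require Import all_boot all_order all_algebra.
From mathcomp Require Import all_classical all_reals all_analysis.

Set Implicit Arguments.
Unset Strict Implicit.
Unset Printing Implicit Defensive.

Import Order.TTheory GRing.Theory Num.Theory.
Import numFieldNormedType.Exports.

Local Open Scope classical_set_scope.
Local Open Scope ring_scope.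

(* C^n is modelled by R^(n + n): the point with complex coordinates
   z_j = x_j + i y_j is the row vector (x_0, .., x_(n-1), y_0, .., y_(n-1)). *)
Section Model.
Context {R : realType} {n : nat}.
Local Notation V := 'rV[R]_(n + n).

(* Multiplication by i. *)
Definition Jmul (v : V) : V := row_mx (- rsubmx v) (lsubmx v).

Definition axis_x (j : 'I_n) : V := delta_mx 0 (lshift n j).
Definition axis_y (j : 'I_n) : V := delta_mx 0 (rshift n j).

Definition zcoord_eq0 (j : 'I_n) (v : V) : Prop :=
  v 0 (lshift n j) = 0 /\ v 0 (rshift n j) = 0.

Section Smooth.
Context {W : normedModType R}.

Fixpoint Ck (k : nat) (U : set V) (f : V -> W) : Prop :=
  match k with
  | 0 => forall x, U x -> {for x, continuous f}
  | k'.+1 => (forall x, U x -> differentiable f x) /\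
             (forall v, Ck k' U (fun x => 'd f x v))
  end.

Definition smooth (U : set V) (f : V -> W) : Prop := forall k, Ck k U f.

End Smooth.

Definition holomorphic (U : set V) (f : V -> V) : Prop :=
  smooth U f /\
  forall x, U x -> forall v, 'd f x (Jmul v) = Jmul ('d f x v).

Definition linear_fun (f : V -> R) : Prop :=
  forall (a : R) (u v : V), f (a *: u + v) = a * f u + f v.

End Model.

(* Only the values of [chart_map] on [dom], and of [chart_inv] on the image of
   [dom] under [chart_map], are meaningful. *)
Record chart (R : realType) (n : nat) (X : Type) := Chart {
  dom : set X;
  chart_map : X -> 'rV[R]_(n + n);
  chart_inv : 'rV[R]_(n + n) -> X }.

Section Charts.
Context {R : realType} {n : nat} {X : topologicalType}.
Implicit Types c d : chart R n X.

Definition image_on c (U : set X) : set 'rV[R]_(n + n) :=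
  chart_map c @` (dom c `&` U).

Definition is_chart c : Prop :=
  [/\ open (dom c) /\ open (chart_map c @` dom c),
      forall y, dom c y -> chart_inv c (chart_map c y) = y,
      forall y, dom c y -> {for y, continuous (chart_map c)} &
      forall z, (chart_map c @` dom c) z -> {for z, continuous (chart_inv c)}].

Definition transition c d : 'rV[R]_(n + n) -> 'rV[R]_(n + n) :=
  chart_map d \o chart_inv c.

Definition compatible c d : Prop :=
  holomorphic (image_on c (dom d)) (transition c d) /\
  holomorphic (image_on d (dom c)) (transition d c).

End Charts.

Record compact_complex_manifold (R : realType) (n : nat) := {
  space :> topologicalType;
  atlas : set (chart R n space);
  space_hausdorff : hausdorff_space space;
  space_compact : compact [set: space];
  atlas_chart : forall c, atlas c -> is_chart c;
  atlas_cover : forall x : space, exists2 c, atlas c & dom c x;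
  atlas_compatible : forall c d, atlas c -> atlas d -> compatible c d;
  atlas_maximal : forall c, is_chart c ->
    (forall d, atlas d -> compatible c d) -> atlas c }.

Section Forms.
Context {R : realType} {n : nat} (X : compact_complex_manifold R n).
Local Notation V := 'rV[R]_(n + n).

(* A form is the family of its expressions in all charts; the expression of
   a form on U in c is meaningful only over [image_on c U]. *)
Definition form1 := chart R n X -> V -> V -> R.
Definition form2 := chart R n X -> V -> V -> V -> R.

Definition is_form1 (U : set X) (a : form1) : Prop :=
  forall c, atlas c ->
  [/\ forall x, image_on c U x -> linear_fun (a c x),
      forall v, smooth (image_on c U) (fun x => a c x v) &
      forall d, atlas d -> forall x, image_on c (dom d `&` U) x -> forall v,
        a c x v = a d (transition c d x) ('d (transition c d) x v)].

Definition is_form2 (w : form2) : Prop :=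
  forall c, atlas c ->
  [/\ forall x, image_on c setT x -> forall u,
        linear_fun (w c x u) /\ linear_fun (fun v => w c x v u),
      forall x, image_on c setT x -> forall u, w c x u u = 0,
      forall u v, smooth (image_on c setT) (fun x => w c x u v) &
      forall d, atlas d -> forall x, image_on c (dom d) x -> forall u v,
        w c x u v = w d (transition c d x) ('d (transition c d) x u)
                                           ('d (transition c d) x v)].

Definition eq_form2 (U : set X) (w w' : form2) : Prop :=
  forall c, atlas c -> forall x, image_on c U x -> forall u v,
    w c x u v = w' c x u v.

Definition d1 (a : form1) : form2 := fun c x u v =>
  'D_u (fun y => a c y v) x - 'D_v (fun y => a c y u) x.

Definition closed2 (w : form2) : Prop :=
  is_form2 w /\
  forall c, atlas c -> forall x, image_on c setT x -> forall u v t,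
    'D_u (fun y => w c y v t) x + 'D_v (fun y => w c y t u) x
      + 'D_t (fun y => w c y u v) x = 0.

Definition exact2 (w : form2) : Prop :=
  exists2 b : form1, is_form1 setT b & eq_form2 setT w (d1 b).

Definition cohomologous (w w' : form2) : Prop :=
  exact2 (fun c x u v => w c x u v - w' c x u v).

(* H^2(X; R) is de Rham cohomology; a class is the set of its closed
   representatives. *)
Definition H2 := set form2.
Definition H2_class (w : form2) : H2 :=
  [set w' | closed2 w' /\ cohomologous w' w].

Definition is_11 (w : form2) : Prop :=
  forall c, atlas c -> forall x, image_on c setT x -> forall u v,
    w c x (Jmul u) (Jmul v) = w c x u v.

(* Fundamental forms of Hermitian metrics. *)
Definition positive11 (w : form2) : Prop :=
  [/\ is_form2 w, is_11 w &
      forall c, atlas c -> forall x, image_on c setT x -> forall u,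
        u != 0 -> 0 < w c x u (Jmul u)].

Definition kahler_form (w : form2) : Prop := closed2 w /\ positive11 w.

(* Relative de Rham cocycles (w, a) of (X, X \ H): w is a closed 2-form on X
   and a is a primitive of w on X \ H. *)
Definition rel_form := (form2 * form1)%type.

Definition rel_cocycle (H : set X) (t : rel_form) : Prop :=
  [/\ closed2 t.1, is_form1 (~` H) t.2 & eq_form2 (~` H) (d1 t.2) t.1].

Definition adapted (H : set X) (c : chart R n X) (j : 'I_n) : Prop :=
  atlas c /\ forall y, dom c y -> (H y <-> zcoord_eq0 j (chart_map c y)).

Definition meridian (z : V) (j : 'I_n) (r t : R) : V :=
  z + r *: (cos t *: axis_x j + sin t *: axis_y j).

Definition meridian_velocity (j : 'I_n) (r t : R) : V :=
  r *: (cos t *: axis_y j - sin t *: axis_x j).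

(* The pairing of (w, a) with a disc B transverse to H at one point is
   \int_B w - \int_(boundary of B) a.  By Stokes it does not depend on the
   radius of B, and the first term tends to 0 with the radius. *)
Definition unit_meridians (H : set X) (t : rel_form) : Prop :=
  forall (c : chart R n X) (j : 'I_n), adapted H c j ->
  forall y, dom c y -> H y ->
    (fun r : R => - Rintegral lebesgue_measure `[0, 2 * pi]
        (fun s => t.2 c (meridian (chart_map c y) j r s)
                        (meridian_velocity j r s))) @ 0^'+ --> (1 : R).

(* A representative of the Thom class of the connected smooth hypersurface H:
   H^2(X, X \ H; R) = R is generated by the unique class whose pairing with
   every meridian disc of H is 1.  Its image in H^2(X; R) is the class [H].
   Such a form always exists for these H, so the default value of [get] plays
   no role; another choice changes the closed 2-form by an exact one. *)
Definition thom_form (H : set X) : rel_form :=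
  get [set t : rel_form | rel_cocycle H t /\ unit_meridians H t].

End Forms.

Section Divisors.
Context {R : realType} {n : nat} {X : compact_complex_manifold R n}.

Section Family.
Context {m : nat} (D : 'I_m -> set X).

Definition snc_divisor : Prop :=
  (forall p, [/\ closed (D p), connected (D p) & D p !=set0]) /\
  forall x : X, exists c (j : 'I_m -> 'I_n),
    [/\ atlas c, dom c x,
        forall p q, D p x -> D q x -> j p = j q -> p = q,
        forall p, D p x -> adapted (D p) c (j p) &
        forall p, ~ D p x -> dom c `&` D p = set0].

(* The form underlying \sum_p l_p Thom(D_p), which is the relative class of
   the R-divisor \sum_p l_p D_p. *)
Definition divisor_form (l : 'rV[R]_m) : form2 X := fun c x u v =>
  \sum_(p < m) l 0 p * (thom_form (D p)).1 c x u v.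

(* R^P = H^2(X, X \ D; R) -> H^2(X; R). *)
Definition im (l : 'rV[R]_m) : H2 X := H2_class (divisor_form l).

(* An R-divisor is ample if its class in H^2(X; R) is a Kaehler class. *)
Definition ample (l : 'rV[R]_m) : Prop :=
  exists2 w, im l w & kahler_form w.

(* Nefness on a compact complex manifold, in the sense of Demailly. *)
Definition nef (l : 'rV[R]_m) : Prop :=
  forall g : form2 X, positive11 g -> forall e : R, 0 < e ->
  exists w, [/\ im l w, is_11 w &
    forall c, atlas c -> forall x, image_on c setT x -> forall u,
      - e * g c x u (Jmul u) <= w c x u (Jmul u)].

Definition Nef : set 'rV[R]_m :=
  [set l : 'rV[R]_m | (forall p, 0 <= l 0 p) /\ nef l].

Definition Amp : set 'rV[R]_m :=
  [set l : 'rV[R]_m | (forall p, 0 < l 0 p) /\ ample l].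

Definition kahler_pair : Prop := snc_divisor /\ Amp !=set0.

(* D_K *)
Definition stratum (K : {set 'I_m}) : set X :=
  [set x | forall p, p \in K -> D p x].

(* The components of D^K. *)
Definition subdivisor (K : {set 'I_m}) : 'I_#|~: K| -> set X :=
  fun i => D (enum_val i).

End Family.
Arguments subdivisor {m} D K _ _.

(* The inclusion of R^(P \ K) in R^P. *)
Definition extend {m : nat} (K : {set 'I_m}) (l : 'rV[R]_#|~: K|) : 'rV[R]_m :=
  \sum_(i < #|~: K|) l 0 i *: delta_mx 0 (enum_val i).

Section Cones.
Context {m : nat} (D : 'I_m -> set X).

Definition Amp' : set (H2 X) :=
  [set h : H2 X | forall K : {set 'I_m}, stratum D K !=set0 ->
    (im (subdivisor D K) @` Amp (subdivisor D K)) h].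

Definition Amp_nice : set 'rV[R]_m :=
  [set a : 'rV[R]_m | Amp D a /\ Amp' (im D a)]°.

End Cones.

(* Cones need not contain 0. *)
Definition convex_cone {m : nat} (S : set 'rV[R]_m) : Prop :=
  (forall a b, S a -> S b -> S (a + b)) /\
  (forall (t : R) a, 0 < t -> S a -> S (t *: a)).

(* A cone is full-dimensional if no proper linear subspace contains it. *)
Definition full_dimensional {m : nat} (S : set 'rV[R]_m) : Prop :=
  S !=set0 /\
  forall W : 'M[R]_m, (forall l, S l -> (l <= W)%MS) -> row_full W.

(* N^K = N \cap R^(P \ K), as a subset of R^(P \ K). *)
Definition cone_face {m : nat} (N : set 'rV[R]_m) (K : {set 'I_m}) :
  set 'rV[R]_#|~: K| := [set l : 'rV[R]_#|~: K| | N (extend l)].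
Arguments cone_face {m} N K _.

Definition nice_cone {m : nat} (D : 'I_m -> set X) (N : set 'rV[R]_m) : Prop :=
  [/\ convex_cone N, full_dimensional N, N `<=` Nef D &
      forall K : {set 'I_m}, stratum D K !=set0 ->
        full_dimensional (cone_face N K) /\
        im D @` N = im (subdivisor D K) @` cone_face N K].

End Divisors.

(* Main.v *)
(* Let a be interior to N, and let l be an ample divisor with positive
   coefficients.  For small t > 0 the divisor a - t l still lies in N, hence is
   nef, so a = (a - t l) + t l is ample with positive coefficients.  For a
   stratum K, a full-dimensional cone in an orthant contains a vector with
   positive coordinates: take b0 in N^K with b0 > 0, let a0 in N and, for small
   s > 0, b1 in N^K have the classes of b0 and a - s a0 respectively; then
   b1 + s b0 > 0 has the class of a. *)

Require Import Defs.
From mathcomp Require Import all_boot all_order all_algebra.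
From mathcomp Require Import all_classical all_reals all_analysis.
From mathcomp Require Import ring lra.

Set Implicit Arguments.
Unset Strict Implicit.

Import Order.TTheory GRing.Theory Num.Theory.
Import numFieldNormedType.Exports.
Local Open Scope classical_set_scope.
Local Open Scope ring_scope.

(** * Calculus of smooth maps on open sets *)

Section Differentiation.
Context {R : realType}.

(** The first-order expansion at [x] sees only the germ there. Both the differentiability of [g] and
    the value of its differential follow from this expansion. *)
Lemma near_eq_diff_locally (V W : normedModType R) (f g : V -> W) (x : V) :
  (\near x, f x = g x) -> differentiable f x ->
  g \o shift x = cst (g x) + 'd f x +o_ 0 id.
Proof.
move=> fg /diff_locally /eqaddoP df; apply/eqaddoP => e e0.
have fg0 : \forall h \near 0, f (h + x) = g (h + x).
  move: fg; rewrite (near_shift 0 x) /=.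
  by apply: filterS => h; rewrite /= subr0.
have fgx : f x = g x by exact: nbhs_singleton fg.
apply: filterS2 fg0 (df e e0) => h fgh.
by rewrite !fctE /= fgh fgx.
Qed.

Lemma near_eq_diff (V W : normedModType R) (f g : V -> W) (x : V) :
  (\near x, f x = g x) -> differentiable f x ->
  'd g x = 'd f x :> (V -> W).
Proof.
move=> fg df; apply: (@diff_unique _ _ _ g ('d f x) x).
  exact: diff_continuous.
exact: near_eq_diff_locally.
Qed.

Lemma near_eq_differentiable (V W : normedModType R) (f g : V -> W) (x : V) :
  (\near x, f x = g x) -> differentiable f x -> differentiable g x.
Proof.
move=> fg df; apply/diff_locallyP; rewrite (near_eq_diff fg df).
by split; [exact: diff_continuous|exact: near_eq_diff_locally].
Qed.

Context {n : nat} {W : normedModType R}.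
Implicit Types f g : 'rV[R]_(n + n) -> W.

(** Since [U] is open, equality on [U] is equality of germs at its points, so the differentials
    agree on [U] and induction applies to them. *)
Lemma eq_Ck (k : nat) (U : set 'rV[R]_(n + n)) f g :
  open U -> (forall x, U x -> f x = g x) -> Ck k U f -> Ck k U g.
Proof.
move=> oU; elim: k f g => [|k IH] f g fg.
  move=> cf x Ux.
  have nfg : \near x, f x = g x.
    by apply: filterS (open_nbhs_nbhs (conj oU Ux)) => y /fg.
  rewrite /prop_for /continuous_at -(fg x Ux).
  have cfx : f @ x --> f x by exact: cf.
  exact: cvg_trans (near_eq_cvg nfg) cfx.
move=> [df Cf].
have nfg x : U x -> \near x, f x = g x.
  by move=> Ux; apply: filterS (open_nbhs_nbhs (conj oU Ux)) => y /fg.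
split=> [x Ux|v].
  exact: near_eq_differentiable (nfg x Ux) (df x Ux).
by apply: IH (Cf v) => x Ux; rewrite (near_eq_diff (nfg x Ux) (df x Ux)).
Qed.

Lemma Ck_addZ (k : nat) (U : set 'rV[R]_(n + n)) f g (t : R) :
  open U -> Ck k U f -> Ck k U g -> Ck k U (f + t *: g).
Proof.
move=> oU; elim: k f g => [|k IH] f g.
  move=> cf cg x Ux; have cfx : f @ x --> f x by exact: cf.
  have cgx : g @ x --> g x by exact: cg.
  exact: cvgD cfx (cvgZl_tmp cgx).
move=> [df Cf] [dg Cg]; split=> [x Ux|v].
  by apply: differentiableD; [exact: df|apply: differentiableZ; exact: dg].
(* The differential of the combination is known to split only at points of [U], hence the passage
   through [eq_Ck]. *)
apply: (eq_Ck oU _ (IH _ _ (Cf v) (Cg v))) => x Ux.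
have dfx : differentiable f x by exact: df.
have dgx : differentiable g x by exact: dg.
have dD := congr1 (@^~ v) (diffD dfx (differentiableZ t dgx)).
have dZ := congr1 (@^~ v) (diffZ t dgx).
by apply/esym/(etrans dD); congr (_ + _).
Qed.

Lemma smooth_addZ (U : set 'rV[R]_(n + n)) f g (t : R) :
  open U -> smooth U f -> smooth U g -> smooth U (f + t *: g).
Proof. by move=> oU sf sg k; apply: Ck_addZ. Qed.

Lemma smooth_derivable (U : set 'rV[R]_(n + n)) f x v :
  smooth U f -> U x -> derivable f x v.
Proof. by move=> /(_ 1%N)[df _] Ux; apply/diff_derivable/df. Qed.

End Differentiation.

(** * Linear combinations of forms, and their classes *)

Section Forms.
Context {R : realType} {n : nat} {X : compact_complex_manifold R n}.
Implicit Types (w : form2 X) (a b : form1 X).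

(** The shape [a + t * b] covers sums ([t = 1]), differences ([t = -1]) and small perturbations at
    once. *)
Definition form1_addZ (t : R) a b : form1 X :=
  fun c x u => a c x u + t * b c x u.

Definition form2_addZ (t : R) w w' : form2 X :=
  fun c x u v => w c x u v + t * w' c x u v.

Lemma open_image_on (c : chart R n X) : atlas c -> open (image_on c setT).
Proof. by move=> /atlas_chart [[_ +] _ _ _]; rewrite /image_on setIT. Qed.

Lemma is_form1_addZ t a b :
  is_form1 setT a -> is_form1 setT b -> is_form1 setT (form1_addZ t a b).
Proof.
move=> fa fb c cA; have [la sa ta] := fa c cA; have [lb sb tb] := fb c cA.
split=> [x Ux k u v|v|d dA x Ux v].
- by rewrite /form1_addZ la // lb //; ring.
- by apply: (smooth_addZ t (open_image_on cA) (sa v) (sb v)).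
- by rewrite /form1_addZ (ta d) // (tb d).
Qed.

Lemma is_form2_addZ t w w' :
  is_form2 w -> is_form2 w' -> is_form2 (form2_addZ t w w').
Proof.
move=> fw fw' c cA.
have [l0 z0 s0 t0] := fw c cA; have [l1 z1 s1 t1] := fw' c cA.
split=> [x Ux u|x Ux u|u v|d dA x Ux u v].
- have [l01 l02] := l0 x Ux u; have [l11 l12] := l1 x Ux u.
  by split=> k v v'; rewrite /form2_addZ ?l01 ?l11 ?l02 ?l12; ring.
- by rewrite /form2_addZ z0 // z1 // mulr0 addr0.
- by apply: (smooth_addZ t (open_image_on cA) (s0 u v) (s1 u v)).
- by rewrite /form2_addZ (t0 d) // (t1 d).
Qed.

Lemma derive_addZ (U : set 'rV[R]_(n + n)) (f g : 'rV[R]_(n + n) -> R) t x v :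
  smooth U f -> smooth U g -> U x ->
  'D_v (fun y => f y + t * g y) x = 'D_v f x + t * 'D_v g x.
Proof.
move=> sf sg Ux.
have df : derivable f x v by exact: smooth_derivable sf Ux.
have dg : derivable g x v by exact: smooth_derivable sg Ux.
have dtg : derivable (t *: g) x v by exact: derivableZ.
by have := deriveD df dtg; rewrite deriveZ.
Qed.

Lemma closed2_addZ t w w' :
  closed2 w -> closed2 w' -> closed2 (form2_addZ t w w').
Proof.
move=> [fw dw] [fw' dw']; split; first exact: is_form2_addZ.
move=> c cA x Ux u v s.
have [_ _ s0 _] := fw c cA; have [_ _ s1 _] := fw' c cA.
rewrite /form2_addZ !(derive_addZ _ _ (s0 _ _) (s1 _ _) Ux).
(* Regroups the cyclic sum into that of [w] plus [t] times that of [w']. *)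
rewrite [X in X + _]addrACA -mulrDr addrACA -mulrDr.
by rewrite (dw c cA x Ux) (dw' c cA x Ux) mulr0 addr0.
Qed.

Lemma exact2_addZ t w w' :
  exact2 w -> exact2 w' -> exact2 (form2_addZ t w w').
Proof.
move=> [b fb eb] [b' fb' eb']; exists (form1_addZ t b b').
  exact: is_form1_addZ.
move=> c cA x Ux u v.
have [_ sb _] := fb c cA; have [_ sb' _] := fb' c cA.
rewrite /form2_addZ (eb c cA x Ux) (eb' c cA x Ux) /d1 /form1_addZ.
by rewrite !(derive_addZ _ _ (sb _) (sb' _) Ux); ring.
Qed.

Lemma is_11_addZ t w w' : is_11 w -> is_11 w' -> is_11 (form2_addZ t w w').
Proof.
by move=> hw hw' c cA x Ux u v; rewrite /form2_addZ hw // hw'.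
Qed.

Lemma form2_ext w w' :
  (forall c x u v, w c x u v = w' c x u v) -> w = w'.
Proof. by move=> e; do 4 (apply/funext => ?); exact: e. Qed.

Lemma cohomologous_addZ t w1 w1' w2 w2' :
  cohomologous w1 w1' -> cohomologous w2 w2' ->
  cohomologous (form2_addZ t w1 w2) (form2_addZ t w1' w2').
Proof.
move=> e1 e2; rewrite /cohomologous.
suff -> : (fun c x u v => form2_addZ t w1 w2 c x u v
    - form2_addZ t w1' w2' c x u v) =
    form2_addZ t (fun c x u v => w1 c x u v - w1' c x u v)
      (fun c x u v => w2 c x u v - w2' c x u v) by exact: exact2_addZ.
by apply: form2_ext => c x u v; rewrite /form2_addZ; ring.
Qed.

Lemma cohomologous_trans w1 w2 w3 :
  cohomologous w1 w2 -> cohomologous w2 w3 -> cohomologous w1 w3.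
Proof.
move=> e1 e2; rewrite /cohomologous.
suff -> : (fun c x u v => w1 c x u v - w3 c x u v) =
    form2_addZ 1 (fun c x u v => w1 c x u v - w2 c x u v)
      (fun c x u v => w2 c x u v - w3 c x u v) by exact: exact2_addZ.
by apply: form2_ext => c x u v; rewrite /form2_addZ; ring.
Qed.

(** Subtracting the two exact differences cancels [w]; this compares two forms through a common
    representative of their classes. *)
Lemma cohomologous_join w w1 w2 :
  cohomologous w w1 -> cohomologous w w2 -> cohomologous w1 w2.
Proof.
move=> e1 e2; rewrite /cohomologous.
suff -> : (fun c x u v => w1 c x u v - w2 c x u v) =
    form2_addZ (-1) (fun c x u v => w c x u v - w2 c x u v)
      (fun c x u v => w c x u v - w1 c x u v) by exact: exact2_addZ.
by apply: form2_ext => c x u v; rewrite /form2_addZ; ring.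
Qed.

Lemma eq_H2_class w w' :
  cohomologous w w' -> cohomologous w' w -> H2_class w = H2_class w'.
Proof.
move=> e e'; apply/seteqP; split=> v [cv ev]; split=> //.
  exact: cohomologous_trans ev e.
exact: cohomologous_trans ev e'.
Qed.

Lemma divisor_form_addZ m (D : 'I_m -> set X) t (a b : 'rV[R]_m) :
  divisor_form D (a + t *: b) =
  form2_addZ t (divisor_form D a) (divisor_form D b).
Proof.
apply: form2_ext => c x u v; rewrite /form2_addZ /divisor_form mulr_sumr.
by rewrite -big_split; apply: eq_bigr => p _; rewrite !mxE /=; ring.
Qed.

(* [H2_class w] is empty when [w] is not closed, so equality of classes gives
   information only when they are inhabited; Kaehler and nef classes are, which
   makes the existence of Thom forms unnecessary. *)
Lemma im_addZ m m' (D : 'I_m -> set X) (D' : 'I_m' -> set X) t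
    (a b : 'rV[R]_m) (a' b' : 'rV[R]_m') :
  im D a !=set0 -> im D b !=set0 -> im D a = im D' a' -> im D b = im D' b' ->
  im D (a + t *: b) = im D' (a' + t *: b').
Proof.
move=> [w wa] [v vb] ea eb.
have [_ e1] := wa; move: wa; rewrite ea => -[_ e1'].
have [_ e2] := vb; move: vb; rewrite eb => -[_ e2'].
rewrite /im !divisor_form_addZ; apply: eq_H2_class; apply: cohomologous_addZ.
- exact: cohomologous_join e1 e1'.
- exact: cohomologous_join e2 e2'.
- exact: cohomologous_join e1' e1.
- exact: cohomologous_join e2' e2.
Qed.

(** With [g] a Kähler form in the class of [b], nefness tested against [g] itself with [e = t / 2]
    gives a representative of [a] bounded below by [- (t / 2) g]; adding [t g] leaves at least
    [(t / 2) g]. *)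
Lemma nef_addZ_ample m (D : 'I_m -> set X) t (a b : 'rV[R]_m) :
  0 < t -> nef D a -> ample D b -> ample D (a + t *: b).
Proof.
move=> t0 na [g [cg eg] [_ pg]]; have [fg g11 gpos] := pg.
have t2 : 0 < t / 2 by rewrite divr_gt0.
have [w [[cw ew] w11 wg]] := na g pg (t / 2) t2.
have cwg : closed2 (form2_addZ t w g) by exact: closed2_addZ.
exists (form2_addZ t w g).
  by split=> //; rewrite divisor_form_addZ; exact: cohomologous_addZ.
split=> //; split; [by case: cwg|exact: is_11_addZ|].
move=> c cA x Ux u u0; rewrite /form2_addZ.
have := wg c cA x Ux u; have := mulr_gt0 t2 (gpos c cA x Ux u u0); lra.
Qed.

End Forms.

(** * Convex cones and their faces *)

Section Cones.
Context {R : realType} {m : nat}.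
Implicit Types (S : set 'rV[R]_m) (a b l : 'rV[R]_m).

Lemma interior_subZ S a b : S° a -> exists2 t : R, 0 < t & S (a - t *: b).
Proof.
move=> Sa.
(* The one-sided limit provides a [t] that is strictly positive. *)
have cv : (fun t : R => a - t *: b) @ 0^'+ --> a.
  have : (fun t : R => a - t *: b) @ 0 --> a - (0 : R) *: b.
    by apply: cvgB; [exact: cvg_cst|apply: cvgZr_tmp; exact: cvg_id].
  by rewrite scale0r subr0; apply: cvg_trans; apply/cvg_app/cvg_within.
have : \forall t \near (0 : R)^'+, 0 < t /\ S (a - t *: b).
  near=> t; split; first by near: t; exact: nbhs_right_gt.
  by near: t; exact: cv.
by move/filter_ex => [t [t0 St]]; exists t.
Unshelve. all: by end_near. Qed.

(** Otherwise [S] lies in the coordinate hyperplane [p], written as [kermx C], which misses the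
    basis vector [p]. *)
Lemma full_dimensional_neq0 S p :
  full_dimensional S -> exists2 l, S l & l 0 p != 0.
Proof.
move=> [_ fS]; apply: contrapT => noS.
pose C : 'cV[R]_m := delta_mx p 0.
have lC (l : 'rV[R]_m) : (l <= kermx C)%MS = (l 0 p == 0).
  rewrite sub_kermx -colE; apply/eqP/eqP => [/matrixP/(_ 0 0)|l0].
    by rewrite !mxE.
  by apply/matrixP => i j; rewrite !mxE !ord1.
have full : row_full (kermx C).
  apply: fS => l Sl; rewrite lC; apply/negPn/negP => l0.
  by apply: noS; exists l.
have := submx_full (delta_mx 0 p : 'rV[R]_m) full.
by rewrite lC mxE !eqxx oner_eq0.
Qed.

(** Add up, over all [p], a vector of [S] whose coordinate [p] is nonzero; no cancellation occurs in
    the orthant. *)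
Lemma full_dimensional_gt0 S :
  convex_cone S -> full_dimensional S ->
  (forall l, S l -> forall p, 0 <= l 0 p) ->
  exists2 l, S l & forall p, 0 < l 0 p.
Proof.
move=> [addS _] fS posS.
have /choice[f fP] p : exists l, S l /\ l 0 p != 0.
  by have [l] := full_dimensional_neq0 p fS; exists l.
(* The extra summand [s] starts the induction, as [S] may omit the empty sum 0. *)
have [[s Ss] _] := fS.
have Sr (r : seq 'I_m) : S (s + \sum_(p <- r) f p).
  elim: r => [|p r IH]; first by rewrite big_nil addr0.
  by rewrite big_cons addrCA; apply: addS IH; case: (fP p).
exists (s + \sum_p f p); first exact: Sr.
move=> p; rewrite (bigD1 p) //= !mxE summxE.
have [Sfp fp0] := fP p.
rewrite ltr_wpDl ?posS// ltr_pwDl ?lt_def ?fp0 ?posS//.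
by apply: sumr_ge0 => q _; apply: posS; case: (fP q).
Qed.

Lemma extendE (K : {set 'I_m}) (l : 'rV[R]_#|~: K|) i :
  extend l 0 (enum_val i) = l 0 i.
Proof.
rewrite /extend summxE (bigD1 i) //= !mxE !eqxx mulr1 big1 ?addr0// => j ji.
by rewrite !mxE (inj_eq enum_val_inj) eq_sym (negPf ji) mulr0.
Qed.

Lemma extend_addZ (K : {set 'I_m}) t (l l' : 'rV[R]_#|~: K|) :
  extend (l + t *: l') = extend l + t *: extend l'.
Proof.
rewrite /extend scaler_sumr -big_split; apply: eq_bigr => i _ /=.
by rewrite !mxE scalerDl scalerA.
Qed.

Lemma convex_cone_addZ S t a b :
  convex_cone S -> 0 < t -> S a -> S b -> S (a + t *: b).
Proof. by move=> [addS scS] t0 Sa Sb; apply/addS/scS. Qed.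

Lemma convex_cone_face S (K : {set 'I_m}) :
  convex_cone S -> convex_cone (@cone_face _ _ S K).
Proof.
move=> cS; split=> [a b Sa Sb|t a t0 Sa]; rewrite /cone_face /=.
  by rewrite -[b]scale1r extend_addZ; apply: convex_cone_addZ.
by rewrite -[t *: a]add0r extend_addZ /extend big1 ?add0r => [|i _];
  [apply: cS.2|rewrite mxE scale0r].
Qed.

End Cones.

(** * Interior points of a nice cone: ampleness for D, then for each D^K *)

Theorem lemma3p28 (R : realType) (n m : nat)
    (X : compact_complex_manifold R n) (D : 'I_m -> set X)
    (N : set 'rV[R]_m) (hD : kahler_pair D) (hN : nice_cone D N) :
  N° `<=` Amp_nice D.
Proof.
have [_ [l0 [l0pos amp0]]] := hD; have [cN fN NNef faceN] := hN.
have [g _ [_ pg]] := amp0.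
(* Nefness tested against the Kähler form [g] with [e = 1] already yields a representative, as
   [im_addZ] requires. *)
have im_neq0 l : N l -> im D l !=set0.
  by move=> /NNef[_ /(_ g pg 1 ltr01)[w [wl _ _]]]; exists w.
(* An open set lies in an interior as soon as it lies in the set itself. *)
rewrite /Amp_nice -(open_subsetE _ (open_interior N)) => a Na.
have [t t0 Nt] := interior_subZ l0 Na.
have [pos_t nef_t] := NNef _ Nt.
have amp_a : ample D a by rewrite -(subrK (t *: l0) a); exact: nef_addZ_ample.
split.
  split=> // p; have := pos_t p; rewrite !mxE.
  have := mulr_gt0 t0 (l0pos p); lra.
move=> K DK; have [fK imK] := faceN K DK.
have [b0 Nb0 b0pos] : exists2 b, @cone_face _ _ N K b & forall p, 0 < b 0 p.
  apply: full_dimensional_gt0 fK _; first exact: convex_cone_face.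
  by move=> l /NNef[pos _] i; rewrite -extendE.
have [a0 Na0 a0b0] : (im D @` N) (im (@subdivisor _ _ _ _ D K) b0).
  by rewrite imK; exists b0.
have [s s0 Ns] := interior_subZ a0 Na.
have [b1 Nb1 b1a] : (im (@subdivisor _ _ _ _ D K) @` @cone_face _ _ N K) (im D (a - s *: a0)).
  by rewrite -imK; exists (a - s *: a0).
have im_a : im D a = im (@subdivisor _ _ _ _ D K) (b1 + s *: b0).
  rewrite -(subrK (s *: a0) a).
  by apply: im_addZ => //; exact: im_neq0.
exists (b1 + s *: b0); last by rewrite im_a.
(* Ampleness depends only on the class in [H2], so it passes from [a] to [b1 + s *: b0]. *)
split; last by case: amp_a => w; rewrite im_a; exists w.
move=> i; rewrite !mxE ltr_wpDl ?mulr_gt0//.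
by rewrite -extendE; case: (NNef _ Nb1).
Qed.
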